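(* Let $\alpha>1$ be an irreducible fraction such that the normalized Jones polynomial $J_\alpha(q)$ is not palindromic. Then $I_\alpha(q)\in\mathbb Z_{\ge0}[q]$ and $I_\alpha(0)=1$.
   Context: Each rational $\alpha=\frac rs>1$ (irreducible, $s>0$) has a unique even-length regular continued fraction $\alpha=[a_1,\ldots,a_{2m}]=a_1+\cfrac{1}{a_2+\cfrac{1}{\ddots+\cfrac1{a_{2m}}}}$ with all $a_i\geq1$. Let $q$ be a formal parameter, $R_q=\begin{pmatrix} q&1\\0&1\end{pmatrix}$, $L_q=\begin{pmatrix}1&0\\1&q^{-1}\end{pmatrix}$, and $M_q(a_1,\ldots,a_{2m})=R_q^{a_1}L_q^{a_2}\cdots R_q^{a_{2m-1}}L_q^{a_{2m}}$. The right $q$-deformed rational number is $[\alpha]^\sharp_q=M_q(a_1,\ldots,a_{2m})\left(\frac10\right)=\frac{\mathcal R^\sharp_\alpha(q)}{\mathcal S^\sharp_\alpha(q)}$ (fractional linear action), where $\mathcal R^\sharp_\alpha,\mathcal S^\sharp_\alpha\in\mathbb Z[q]$ are obtained from the first column of $M_q(a_1,\ldots,a_{2m})$ by multiplying by a common $\pm q^n$ so that $\mathcal S^\sharp_\alpha(0)=1$. Let $L(\alpha)$ be the rational (2-bridge) link in $\mathbb S^3$ associated with $\alpha$, given by the standard diagram with successive twist regions of $-a_1,a_2,-a_3,\ldots,-a_{2m-1},a_{2m}$ half twists, and $V_{L(\alpha)}(t)$ its Jones polynomial. The normalized Jones polynomial is $J_\alpha(q):=\pm t^{-h}V_{L(\alpha)}(t)|_{t=-q^{-1}}$,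 where $\pm t^h$ is the leading term of $V_{L(\alpha)}(t)$, so that $J_\alpha(q)\in\mathbb Z[q]$ has constant term $1$. By a known theorem of Morier-Genoud and Ovsienko, $J_\alpha(q)=q\,\mathcal R^\sharp_\alpha(q)+(1-q)\,\mathcal S^\sharp_\alpha(q)$; this may be taken as the definition of $J_\alpha(q)$. For $f\in\mathbb Z[q]$, $f(q)^\vee:=q^{\deg f}f(q^{-1})$, and $f$ is palindromic if $f=f^\vee$. When $J_\alpha(q)$ is not palindromic, $I_\alpha(q)$ is the unique polynomial in $\mathbb Z[q]$ with $I_\alpha(0)>0$ of the form $I_\alpha(q)=\pm q^N\,\frac{J_\alpha(q)^\vee-J_\alpha(q)}{1-q}$ for some $N\in\mathbb Z$ and some sign. *)

(* Defs.v *)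
From mathcomp Require Import all_boot all_order all_algebra fraction.
From mathcomp Require Import boolp classical_sets.

Set Implicit Arguments.
Unset Strict Implicit.
Unset Printing Implicit Defensive.

Import Order.TTheory GRing.Theory Num.Theory.
Local Open Scope ring_scope.

(* The objects that are defined as "the unique x such that P x" are written
   xget x0 [set x | P x]; the default x0 is only reached when there is no such
   x. *)

Notation Zq := {poly int}.
(* The field Q(q), in which the Laurent polynomials in q live. *)
Notation Qq := {fraction {poly int}}.

Definition toQq (f : Zq) : Qq := FracField.tofrac f.

Definition q : Qq := toQq 'X.

(* The convention 0^-1 = 0 makes the innermost term of [:: a1; ...; an] equal
   to an, and the value of the empty sequence is 0. *)
Definition cf_value (a : seq nat) : rat :=
  foldr (fun (k : nat) (x : rat) => k%:R + x^-1) 0 a.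

Definition is_even_cf (alpha : rat) (a : seq nat) : Prop :=
  [/\ ~~ odd (size a), all (leq 1) a & cf_value a = alpha].

Definition even_cf (alpha : rat) : seq nat :=
  xget [::] [set a | is_even_cf alpha a].

Definition mx2 (a b c d : Qq) : 'M[Qq]_2 :=
  \matrix_(i, j) if i == 0 then (if j == 0 then a else b)
                 else (if j == 0 then c else d).

Definition Rq : 'M[Qq]_2 := mx2 q 1
                                0 1.
Definition Lq : 'M[Qq]_2 := mx2 1 0
                                1 q^-1.

(* The product is taken in increasing order of the index i, which starts at 0:
   an even i is an odd position in the continued fraction. *)
Definition Mq (a : seq nat) : 'M[Qq]_2 :=
  \prod_(i < size a) (if odd i then Lq else Rq) ^+ nth 0%N a i.

(* RS is the pair (numerator, denominator). *)
Definition is_right_qrat (alpha : rat) (RS : Zq * Zq) : Prop :=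
  let M := Mq (even_cf alpha) in
  RS.2.[0] = 1 /\
  exists (e : bool) (n : int),
    toQq RS.1 = (-1) ^+ e * q ^ n * M 0 0 /\
    toQq RS.2 = (-1) ^+ e * q ^ n * M 1 0.

Definition right_qrat (alpha : rat) : Zq * Zq :=
  xget (0, 0) [set RS | is_right_qrat alpha RS].

Definition Rsharp (alpha : rat) : Zq := (right_qrat alpha).1.
Definition Ssharp (alpha : rat) : Zq := (right_qrat alpha).2.

(* The normalized Jones polynomial of the rational link of alpha, through the
   formula of Morier-Genoud and Ovsienko. *)
Definition jones (alpha : rat) : Zq :=
  'X * Rsharp alpha + (1 - 'X) * Ssharp alpha.

(* q ^ deg f * f(1/q); the list of coefficients of f has no trailing zero but
   may have leading zeros, which are dropped by Poly after the reversal. *)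
Definition recip (f : Zq) : Zq := Poly (rev f).

Definition palindromic (f : Zq) : Prop := f = recip f.

Definition is_Ipoly (alpha : rat) (f : Zq) : Prop :=
  0 < f.[0] /\
  exists (e : bool) (N : int),
    toQq f = (-1) ^+ e * q ^ N
             * (toQq (recip (jones alpha) - jones alpha) / toQq (1 - 'X)).

Definition Ipoly (alpha : rat) : Zq := xget 0 [set f | is_Ipoly alpha f].

(* Main.v *)
Require Import Defs.
From mathcomp Require Import all_boot all_order all_algebra.
From mathcomp Require Import fraction classical_sets ring.

Import Order.TTheory GRing.Theory Num.Theory.
Local Open Scope ring_scope.

(** The product Mq of an even continued fraction is a word R U L in the letters
    R = Rq and L = Lq. Replacing Lq by q Lq changes the product by a power of q
    only and makes all entries polynomials; normalizing the first column then
    gives J = (q^2, 1) U (1, 1)^T, whose constant term is 1.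

    Inverting q exchanges R and q L, up to a power of q and the exchange of the
    two coordinates. Hence the reciprocal of J(U) is J(U'), where U' is U with
    its two letters exchanged ([recip_jones_word]). On the other hand R and q L
    have the same trace and determinant, and an explicit matrix T conjugates
    each of them into the other. So U' = T U T^-1, which makes J(U') linear in
    the entries of U; one finds ([jones_word_swapB])
<<
      J(U') - J(U) = (1 - q) (q U01 - U10).
>>
    It remains to study the linear form phi(U) = q U01 - U10. If the first and
    the last letter of U differ, deleting both divides phi by q; if they are
    equal, then phi(U) is, up to a sign, q times a sum of entries of the inner
    word, some of them multiplied by q, and this sum has nonnegative
    coefficients and constant term 1. Peeling off unequal outer letters until
    they are equal or at most one letter is left shows that phi(U) is zero or,
    up to a sign and a power of q, a polynomial with nonnegative coefficients
    and constant term 1 ([skew_word_factor]). It is zero exactly when J is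
    palindromic, and otherwise this polynomial is I, because a polynomial with
    positive constant term is determined by its class modulo signs and powers
    of q ([monomial_multiple_trivial]). *)

(** * Words in R and qL *)

Lemma mulmx2E (K : comNzRingType) (A B : 'M[K]_2) i j :
  (A * B) i j = A i 0 * B 0 j + A i 1 * B 1 j.
Proof.
rewrite -mulmxE mxE big_ord_recl big_ord1.
by have -> : lift ord0 ord0 = 1 :> 'I_2 by apply/val_inj.
Qed.

Lemma matrix2P (K : comNzRingType) (A B : 'M[K]_2) :
  [/\ A 0 0 = B 0 0, A 0 1 = B 0 1, A 1 0 = B 1 0 & A 1 1 = B 1 1] -> A = B.
Proof.
case=> h00 h01 h10 h11; apply/matrixP=> i j.
have ord2 (k : 'I_2) : k = 0 \/ k = 1.
  by case: k => [[|[|k]]] // lt_k2; [left | right]; apply/val_inj.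
by case: (ord2 i) => ->; case: (ord2 j) => ->.
Qed.

(** R for [true] and q L for [false]. *)
Definition letter (b : bool) : 'M[Zq]_2 :=
  \matrix_(i, j) if i == 0 then (if j == 0 then 'X else b%:R)
                 else (if j == 0 then (~~ b)%:R * 'X else 1).

Definition wordmx (w : seq bool) : 'M[Zq]_2 := \prod_(b <- w) letter b.

Definition swap_word (w : seq bool) : seq bool := map negb w.

(** The value (q^2, 1) U (1, 1)^T. The letters R and L that surround U in a
    continued fraction are absorbed in the two vectors; see [jones_is_word]. *)
Definition jones_word (w : seq bool) : Zq :=
  'X ^+ 2 * (wordmx w 0 0 + wordmx w 0 1) + (wordmx w 1 0 + wordmx w 1 1).

(** The form phi, which spans the linear forms that change sign under the
    exchange of the two letters and vanish on both products of two distinct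
    letters. *)
Definition skew_word (w : seq bool) : Zq :=
  'X * wordmx w 0 1 - wordmx w 1 0.

Lemma letterE b :
  ((letter b 0 0 = 'X)%R * (letter b 0 1 = b%:R)%R *
   (letter b 1 0 = (~~ b)%:R * 'X)%R * (letter b 1 1 = 1)%R)%type.
Proof. by rewrite !mxE. Qed.

Lemma wordmx_nil : wordmx [::] = 1.
Proof. exact: big_nil. Qed.

Lemma wordmx_cons b w : wordmx (b :: w) = letter b * wordmx w.
Proof. exact: big_cons. Qed.

Lemma wordmx_rcons b w : wordmx (rcons w b) = wordmx w * letter b.
Proof. by rewrite /wordmx -cats1 big_cat big_seq1. Qed.

Lemma wordmx_coef_ge0 w i j k : 0 <= (wordmx w i j)`_k.
Proof.
elim: w i j k => [|b w IHw] i j k.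
  by rewrite wordmx_nil mxE; case: (i == j); rewrite ?coef1 ?coef0 //; case: k.
rewrite wordmx_cons mulmx2E coefD addr_ge0 // mxE.
  by case: (i == 0); case: b; rewrite /= ?mul1r ?mul0r ?coef0 ?coefXM //;
     case: ifP.
by case: (i == 0); case: b; rewrite /= ?mul1r ?mul0r ?coef0 // IHw.
Qed.

(** At q = 0 both letters have second row (0, 1). All the constant terms equal
    to 1 below come from here. *)
Lemma wordmx_row1_at0 w :
  (wordmx w 1 0).[0] = 0 /\ (wordmx w 1 1).[0] = 1.
Proof.
elim: w => [|b w [IH0 IH1]]; first by rewrite wordmx_nil !mxE /= !hornerE.
by rewrite wordmx_cons !mulmx2E !letterE !mul1r !hornerE IH0 IH1.
Qed.

Lemma jones_word_at0 w : (jones_word w).[0] = 1.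
Proof.
have [h10 h11] := wordmx_row1_at0 w.
by rewrite /jones_word expr2 !hornerE h10 h11.
Qed.

(** * Exchanging the two letters *)

(** The matrix T with (qL) T = T R and R T = T (qL). Its square is the scalar
    q^2 - q + 1. *)
Definition swapper : 'M[Zq]_2 :=
  \matrix_(i, j) if i == 0 then (if j == 0 then 'X - 1 else 1)
                 else (if j == 0 then 'X else 1 - 'X).

Lemma swapperE :
  ((swapper 0 0 = 'X - 1)%R * (swapper 0 1 = 1)%R *
   (swapper 1 0 = 'X)%R * (swapper 1 1 = 1 - 'X)%R)%type.
Proof. by rewrite !mxE. Qed.

Lemma letter_swapper b : letter (~~ b) * swapper = swapper * letter b.
Proof.
by apply: matrix2P; rewrite !mulmx2E !letterE !swapperE; case: b => /=;
   split; ring.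
Qed.

Lemma wordmx_swapper w : wordmx (swap_word w) * swapper = swapper * wordmx w.
Proof.
elim: w => [|b w IHw]; first by rewrite wordmx_nil mul1r mulr1.
by rewrite /= !wordmx_cons -mulrA IHw !mulrA letter_swapper.
Qed.

(** Since T (q, 1)^T = c (1, 1)^T and (q^2, 1) T = c (q, 1) for
    c = q^2 - q + 1, the relation U' T = T U turns (q^2, 1) U' (1, 1)^T into
    (q, 1) U (q, 1)^T. *)
Lemma jones_word_swapB w :
  jones_word (swap_word w) - jones_word w = (1 - 'X) * skew_word w.
Proof.
have nz : 'X ^+ 2 - 'X + 1 != 0 :> Zq.
  by apply/negP=> /eqP/(congr1 (horner^~ 0)); rewrite expr2 !hornerE.
have := wordmx_swapper w.
set A := wordmx w; set B := wordmx (swap_word w) => eqBA.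
have e i j : B i 0 * swapper 0 j + B i 1 * swapper 1 j =
             swapper i 0 * A 0 j + swapper i 1 * A 1 j.
  by rewrite -!mulmx2E eqBA.
have := (e 0 0, e 0 1, e 1 0, e 1 1).
rewrite !swapperE => -[[[e00 e01] e10] e11].
apply: (mulfI nz); rewrite /jones_word /skew_word -/A -/B.
(* c (q^2, 1) U' (1, 1)^T, rewritten as (q^2, 1) (U' T) (q, 1)^T *)
have : ('X ^+ 2 - 'X + 1) * ('X ^+ 2 * (B 0 0 + B 0 1) + (B 1 0 + B 1 1)) =
  ('X ^+ 2 * ('X * (B 0 0 * ('X - 1) + B 0 1 * 'X) +
              (B 0 0 * 1 + B 0 1 * (1 - 'X))) +
     ('X * (B 1 0 * ('X - 1) + B 1 1 * 'X) +
              (B 1 0 * 1 + B 1 1 * (1 - 'X)))) by ring.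
rewrite e00 e01 e10 e11 mulrBr => ->; ring.
Qed.

(** * Reciprocal polynomials *)

(** f(q) = q^n g(1/q), with the degree n prescribed: unlike the reciprocal, this
    relation is compatible with sums. *)
Definition mutually_reversed (n : nat) (f g : Zq) : Prop :=
  (size g <= n.+1)%N /\
  forall i, f`_i = if (i <= n)%N then g`_(n - i) else 0.

Lemma mutually_reversedD n f1 f2 g1 g2 :
  mutually_reversed n f1 g1 -> mutually_reversed n f2 g2 ->
  mutually_reversed n (f1 + f2) (g1 + g2).
Proof.
move=> [s1 h1] [s2 h2]; split.
  by rewrite (leq_trans (size_polyD _ _)) // geq_max s1.
by move=> i; rewrite !coefD h1 h2; case: ifP => // _; rewrite addr0.
Qed.

Lemma mutually_reversedXl n f g :
  mutually_reversed n f g -> mutually_reversed n.+1 ('X * f) g.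
Proof.
move=> [sg fg]; split=> [|[|i]]; rewrite ?coefXM ?fg //; first exact: leqW.
by rewrite /= nth_default.
Qed.

Lemma mutually_reversedXr n f g :
  mutually_reversed n f g -> mutually_reversed n.+1 f ('X * g).
Proof.
move=> [sg fg]; split=> [|i].
  by rewrite (leq_trans (size_polyMleq _ _)) // size_polyX.
rewrite coefXM fg; case: (ltngtP i n.+1) => [lt_in|lt_ni|->].
- by rewrite -ltnS lt_in subSn.
- by rewrite leqNgt (leq_trans _ lt_ni).
- by rewrite ltnn subnn.
Qed.

Lemma recip_mutually_reversed n f g :
  mutually_reversed n f g -> f`_0 != 0 -> g`_0 != 0 -> recip f = g.
Proof.
move=> [sg fg] f0 g0.
have sf : size f = n.+1.
  apply/eqP; rewrite eqn_leq; apply/andP; split.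
    by apply/leq_sizeP => j lt_nj; rewrite fg leqNgt lt_nj.
  rewrite ltnNge; apply: contra g0 => le_fn.
  by have := fg n; rewrite leqnn subnn nth_default // => <-.
apply/polyP=> i; rewrite coef_Poly; case: (ltnP i n.+1) => [lt_in|le_ni].
  by rewrite nth_rev sf // subSS fg leq_subr subKn.
by rewrite !nth_default // ?(leq_trans sg) // size_rev sf.
Qed.

(** Up to the exchange of the two coordinates, qL is q times the value of R at
    1/q. By induction, the two coordinates of U (1, 1)^T are the reversals of
    those of U' (1, 1)^T in the opposite order, in degree the length of U. *)
Lemma recip_jones_word w : recip (jones_word w) = jones_word (swap_word w).
Proof.
pose top v := wordmx v 0 0 + wordmx v 0 1.
pose bot v := wordmx v 1 0 + wordmx v 1 1.
have topS b v : top (b :: v) = 'X * top v + b%:R * bot v.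
  by rewrite /top /bot wordmx_cons !mulmx2E !letterE; ring.
have botS b v : bot (b :: v) = (~~ b)%:R * ('X * top v) + bot v.
  by rewrite /top /bot wordmx_cons !mulmx2E !letterE; ring.
have [top_rev bot_rev] :
    mutually_reversed (size w) (top w) (bot (swap_word w)) /\
    mutually_reversed (size w) (bot w) (top (swap_word w)).
  elim: w => [|b v [IHt IHb]].
    by rewrite /top /bot wordmx_nil !mxE /= addr0 add0r; split; split=> [|i];
       rewrite ?size_poly1 // coef1 coef1; case: i.
  have sum_rev : mutually_reversed (size v).+1
      ('X * top v + bot v) ('X * top (swap_word v) + bot (swap_word v)).
    rewrite [X in mutually_reversed _ _ X]addrC.
    exact: mutually_reversedD
      (mutually_reversedXl _ _ _ _) (mutually_reversedXr _ _ _ _).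
  rewrite /= !topS !botS; case: b; rewrite /= ?mul1r ?mul0r ?addr0 ?add0r.
    by split=> //; apply: mutually_reversedXr.
  by split=> //; apply: mutually_reversedXl.
have coef0_jones v : (jones_word v)`_0 != 0.
  by rewrite -horner_coef0 jones_word_at0.
apply: (recip_mutually_reversed (size w).+2) => //.
rewrite /jones_word -/(top _) -/(bot _).
rewrite -/(top (swap_word w)) -/(bot (swap_word w)).
rewrite [X in mutually_reversed _ _ X]addrC !expr2 -!mulrA.
by apply: mutually_reversedD;
   do 2?[apply: mutually_reversedXl | apply: mutually_reversedXr].
Qed.

(** * The form phi on words *)

Definition nonneg_normalized (f : Zq) : Prop :=
  (forall i, 0 <= f`_i) /\ f.[0] = 1.

Lemma skew_word_RL w :
  skew_word (true :: rcons w false) = 'X * skew_word w.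
Proof.
by rewrite /skew_word wordmx_cons wordmx_rcons !mulmx2E !letterE /=; ring.
Qed.

Lemma skew_word_LR w :
  skew_word (false :: rcons w true) = 'X * skew_word w.
Proof.
by rewrite /skew_word wordmx_cons wordmx_rcons !mulmx2E !letterE /=; ring.
Qed.

Lemma skew_word_RR w : skew_word (true :: rcons w true) =
  'X * ('X * (wordmx w 0 0 + wordmx w 0 1) + wordmx w 1 1).
Proof.
by rewrite /skew_word wordmx_cons wordmx_rcons !mulmx2E !letterE /=; ring.
Qed.

Lemma skew_word_LL w : skew_word (false :: rcons w false) =
  - 'X * ('X * wordmx w 0 0 + (wordmx w 1 0 + wordmx w 1 1)).
Proof.
by rewrite /skew_word wordmx_cons wordmx_rcons !mulmx2E !letterE /=; ring.
Qed.

(** Unequal outer letters are removed at the cost of a factor q. Once they are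
    equal, [skew_word_RR] and [skew_word_LL] give g directly. *)
Lemma skew_word_factor w : skew_word w != 0 ->
  exists (e : bool) (k : nat) (g : Zq),
    skew_word w = (-1) ^+ e * 'X ^+ k * g /\ nonneg_normalized g.
Proof.
have coefX_ge0 (f : Zq) i : (forall j, 0 <= f`_j) -> 0 <= ('X * f)`_i.
  by move=> f0; rewrite coefXM; case: ifP.
elim: {w}(size w) {-2}w (leqnn (size w)) => [|n IHn] w le_wn nz_w.
  move: le_wn nz_w; rewrite leqn0 size_eq0 => /eqP->.
  by rewrite /skew_word wordmx_nil !mxE /= mulr0 subr0 eqxx.
case: w le_wn nz_w => [|b w] /=; first by move=> _; apply: IHn.
rewrite ltnS; case/lastP: w => [|w c].
  move=> _ _; exists (~~ b), 1%N, 1; split.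
    rewrite /skew_word wordmx_cons wordmx_nil mulr1 !letterE.
    by case: b; rewrite /=; ring.
  by split=> [i|]; rewrite ?coef1 ?hornerE //; case: i.
rewrite size_rcons => lt_wn.
have [h10 h11] := wordmx_row1_at0 w.
have step : skew_word w != 0 -> exists (e : bool) (k : nat) (g : Zq),
    'X * skew_word w = (-1) ^+ e * 'X ^+ k * g /\ nonneg_normalized g.
  case/(IHn w (ltnW lt_wn)) => e [k [g [-> norm_g]]].
  by exists e, k.+1, g; split=> //; rewrite exprS; ring.
case: b; case: c.
- move=> _; rewrite skew_word_RR; eexists false, 1%N, _; split.
    by rewrite expr0 expr1 mul1r.
  split=> [i|]; last by rewrite !hornerE h11 ?add0r.
  by rewrite coefD addr_ge0 ?coefX_ge0 // => [j|];
     rewrite ?coefD ?addr_ge0 ?wordmx_coef_ge0.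
- by rewrite skew_word_RL mulf_eq0 polyX_eq0.
- by rewrite skew_word_LR mulf_eq0 polyX_eq0.
- move=> _; rewrite skew_word_LL; eexists true, 1%N, _; split.
    by rewrite expr1 expr1 mulN1r.
  split=> [i|]; last by rewrite !hornerE h10 h11 ?add0r.
  by rewrite !coefD !addr_ge0 ?coefX_ge0 ?wordmx_coef_ge0 // => j;
     rewrite wordmx_coef_ge0.
Qed.

(** * Normalization up to signs and powers of q *)

Lemma q_neq0 : q != 0.
Proof. by rewrite /q /toQq tofrac_eq0 polyX_eq0. Qed.

(** A nonzero power of q would make one of the two constant terms vanish, and
    the sign must then be positive. *)
Lemma monomial_multiple_trivial (e : bool) (n : int) (f g : Zq) :
  0 < f.[0] -> 0 < g.[0] -> toQq f = (-1) ^+ e * q ^ n * toQq g ->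
  (-1) ^+ e * q ^ n = 1.
Proof.
have nat_case (k : nat) (u v : Zq) : 0 < u.[0] -> 0 < v.[0] ->
    u = (-1) ^+ e * 'X ^+ k * v -> (e == false) && (k == 0)%N.
  move=> u0 v0 E; move: u0.
  rewrite E !hornerM hornerXn horner_exp hornerN hornerC.
  case: k {E} => [|k]; last by rewrite exprS mul0r mulr0 mul0r ltxx.
  by case: e; rewrite ?expr1 ?expr0 ?mulN1r ?mulr1 ?mul1r //
     oppr_gt0 => /(lt_trans v0); rewrite ltxx.
have toQqM (u v : Zq) : toQq u * toQq v = toQq (u * v) by rewrite /toQq rmorphM.
have toQqX (k : nat) : q ^+ k = toQq ('X ^+ k) by rewrite /q /toQq rmorphXn.
have toQqs : (-1) ^+ e = toQq ((-1) ^+ e) by rewrite /toQq rmorphXn rmorphN1.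
have toQq_inj (u v : Zq) : toQq u = toQq v -> u = v.
  by move/eqP; rewrite /toQq tofrac_eq => /eqP.
move=> f0 g0; case: n => k E.
  move: E; rewrite -exprnP toQqs toQqX !toQqM.
  move=> /toQq_inj/(nat_case _ _ _ f0 g0).
  by case/andP=> /eqP-> /eqP->; rewrite /toQq !expr0 mulr1 rmorph1.
suff /andP[/eqP-> /eqP] : (e == false) && (k.+1 == 0)%N by [].
apply: (nat_case _ _ _ g0 f0); apply: toQq_inj.
rewrite -!toQqM E -toQqs -toQqX NegzE -exprnN.
rewrite mulrA mulrACA -expr2 sqrr_sign mul1r mulfV ?mul1r //.
by rewrite expf_neq0 ?q_neq0.
Qed.

(** * The word of a continued fraction *)

(** [b] is the letter of the first block. *)
Fixpoint cf_word (b : bool) (a : seq nat) : seq bool :=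
  if a is k :: a' then nseq k b ++ cf_word (~~ b) a' else [::].

Lemma cf_word_rcons b a k :
  cf_word b (rcons a k) = cf_word b a ++ nseq k (b (+) odd (size a)).
Proof.
elim: a b => [|l a IHa] b /=; first by rewrite cats0 addbF.
by rewrite IHa catA addNb addbN.
Qed.

Lemma cf_word_even a :
  a != [::] -> ~~ odd (size a) -> all (leq 1) a ->
  exists w, cf_word true a = true :: rcons w false.
Proof.
case: a => // -[|k] a //= _; case/lastP: a => // a l.
rewrite size_rcons /= negbK all_rcons => even_a /andP[l_gt0 _].
rewrite cf_word_rcons (negbTE even_a) /= -(prednK l_gt0) -addn1 nseqD catA.
exists (nseq k true ++ cf_word false a ++ nseq l.-1 false).
by rewrite -cats1 !catA.
Qed.

Definition laurent_letter (b : bool) : 'M[Qq]_2 := if b then Rq else Lq.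

Lemma Mq_cf_word a :
  Mq a = \prod_(b <- cf_word true a) laurent_letter b.
Proof.
suff H b : \prod_(i < size a) laurent_letter (odd i (+) b) ^+ nth 0%N a i
    = \prod_(c <- cf_word b a) laurent_letter c.
  by rewrite -(H true); apply: eq_bigr => i _; case: (odd i).
elim: a b => [|k a IHa] b; first by rewrite big_ord0 big_nil.
rewrite big_ord_recl big_cat -IHa /=; congr (_ * _).
  by elim: k => [|k IHk]; rewrite ?big_nil ?expr0 // big_cons -IHk exprS.
by apply: eq_bigr => i _; rewrite addNb addbN.
Qed.

Lemma Mq_wordmx a i j (w := cf_word true a) :
  q ^+ count negb w * Mq a i j = toQq (wordmx w i j).
Proof.
rewrite Mq_cf_word -/w.
have letterQ b :
    q ^+ (~~ b) *: laurent_letter b = map_mx (@FracField.tofrac _) (letter b).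
  by apply: matrix2P; rewrite /laurent_letter; case: b; rewrite !mxE /=;
     split; rewrite ?mul1r ?mul0r ?mulr1 ?mulr0
                    ?rmorph0 ?rmorph1 ?mulfV ?q_neq0.
suff : q ^+ count negb w *: \prod_(b <- w) laurent_letter b
     = map_mx (@FracField.tofrac _) (wordmx w).
  by move=> /matrixP/(_ i j); rewrite !mxE.
elim: w => [|b w IHw]; first by rewrite wordmx_nil big_nil scale1r map_mx1.
rewrite wordmx_cons big_cons -mulmxE map_mxM -IHw -letterQ /= exprD.
by rewrite -scalemxAl -scalemxAr scalerA.
Qed.

(** For the empty sequence the first column of Mq is (1, 0)^T, and no multiple
    of 0 has constant term 1: the pair (R, S) then takes its default value. *)
Lemma jones_nil alpha : even_cf alpha = [::] -> jones alpha = 0.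
Proof.
move=> cf_nil.
have Mnil : Mq [::] = 1 by rewrite /Mq big_ord0.
have norat RS : ~ is_right_qrat alpha RS.
  rewrite /is_right_qrat cf_nil Mnil => -[RS0 [e [n [_]]]].
  rewrite mxE mulr0 /toQq => /eqP; rewrite tofrac_eq0 => /eqP S0.
  by move: RS0; rewrite S0 horner0 => /esym/eqP; rewrite oner_eq0.
rewrite /jones /Rsharp /Ssharp /right_qrat xgetPN.
  by rewrite !mulr0 addr0.
by move=> RS; apply: norat.
Qed.

Lemma even_cfP alpha :
  even_cf alpha != [::] -> is_even_cf alpha (even_cf alpha).
Proof.
by rewrite /even_cf; case: xgetP => [a -> //|_]; rewrite eqxx.
Qed.

(** The first column of R U (qL) is q R U (1, 1)^T. Without the factor q, its
    second entry has constant term 1 and so the column is the normalized pair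
    (R, S); moreover (q, 1 - q) R = (q^2, 1). *)
Lemma jones_is_word alpha :
  even_cf alpha != [::] -> exists w, jones alpha = jones_word w.
Proof.
move=> nz_cf; have [even_a a_pos _] := even_cfP _ nz_cf.
have [w def_w] := cf_word_even _ nz_cf even_a a_pos.
pose A := wordmx w.
pose RS0 : Zq * Zq := ('X * (A 0 0 + A 0 1) + (A 1 0 + A 1 1), A 1 0 + A 1 1).
exists w; set M := Mq (even_cf alpha).
pose m := count negb (cf_word true (even_cf alpha)).
have M_col i f : wordmx (true :: rcons w false) i 0 = 'X * f ->
    M i 0 = q ^ (1 - m%:Z) * toQq f.
  move=> eq_f; apply: (mulfI (expf_neq0 m q_neq0)).
  rewrite Mq_wordmx def_w eq_f mulrA /= exprnP -expfzDr ?q_neq0 // addrC subrK.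
  by rewrite expr1z /q /toQq rmorphM.
have M00 : M 0 0 = q ^ (1 - m%:Z) * toQq RS0.1.
  by apply: M_col; rewrite wordmx_cons wordmx_rcons !mulmx2E !letterE /=; ring.
have M10 : M 1 0 = q ^ (1 - m%:Z) * toQq RS0.2.
  by apply: M_col; rewrite wordmx_cons wordmx_rcons !mulmx2E !letterE /=; ring.
have RS0_0 : RS0.2.[0] = 1.
  by have [h10 h11] := wordmx_row1_at0 w; rewrite hornerD h10 h11 add0r.
suff -> : jones alpha = 'X * RS0.1 + (1 - 'X) * RS0.2.
  by rewrite /jones_word /=; ring.
suff rat_RS0 : right_qrat alpha = RS0.
  by rewrite /jones /Rsharp /Ssharp rat_RS0.
rewrite /right_qrat; case: xgetP => [RS _ [RS_0 [e [n]]] | no]; last first.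
  case: (no RS0); split=> //; exists false, (m%:Z - 1).
  rewrite -/M M00 M10 mul1r !mulrA -expfzDr ?q_neq0 //.
  by rewrite addrA subrK subrr expr0z !mul1r.
rewrite -/M M00 M10 !mulrA -[_ * q ^ n * _]mulrA -expfzDr ?q_neq0 //.
move=> -[R1 S1].
have one := monomial_multiple_trivial _ _ _ _ _ _ S1.
move: R1 S1; rewrite one ?RS_0 ?RS0_0 // !mul1r /toQq => /eqP R1 /eqP S1.
rewrite !tofrac_eq in R1 S1.
by rewrite [LHS]surjective_pairing (eqP R1) (eqP S1).
Qed.

Theorem corollary4p13 (alpha : rat) (halpha : 1 < alpha)
    (hJ : ~ palindromic (jones alpha)) :
  (forall i : nat, 0 <= (Ipoly alpha)`_i) /\ (Ipoly alpha).[0] = 1.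
Proof.
have [cf_nil | nz_cf] := eqVneq (even_cf alpha) [::].
  case: hJ; rewrite /palindromic jones_nil // /recip polyseq0.
  by apply/val_inj; rewrite /= polyseq0.
have [w def_J] := jones_is_word _ nz_cf.
have recipB : recip (jones alpha) - jones alpha = (1 - 'X) * skew_word w.
  by rewrite def_J recip_jones_word jones_word_swapB.
have nz_skew : skew_word w != 0.
  apply/eqP=> skew0; apply: hJ; move: recipB; rewrite skew0 mulr0.
  by move/subr0_eq.
have [e [k [g [def_skew [g_ge0 g_0]]]]] := skew_word_factor w nz_skew.
have nz_1X : toQq (1 - 'X) != 0.
  rewrite /toQq tofrac_eq0; apply/negP=> /eqP/(congr1 (horner^~ 0)).
  by rewrite !hornerE.
have quotE : toQq (recip (jones alpha) - jones alpha) / toQq (1 - 'X)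
    = (-1) ^+ e * q ^ k * toQq g.
  rewrite recipB def_skew /q /toQq -exprnP !rmorphM /=.
  rewrite [_ * _ / _]mulrC mulKf //.
  by rewrite !rmorphXn rmorphN1.
suff -> : Ipoly alpha = g by [].
rewrite /Ipoly; case: xgetP => [f _ [f0 [e' [N]]] | no]; last first.
  case: (no g); split; first by rewrite g_0.
  exists e, (- k%:Z); rewrite quotE mulrA mulrACA -expr2 sqrr_sign mul1r.
  by rewrite -expfzDr ?q_neq0 // addNr expr0z mul1r.
rewrite quotE mulrA mulrACA -signr_addb -expfzDr ?q_neq0 // => def_f.
move: def_f (def_f) => /monomial_multiple_trivial -> //; last by rewrite g_0.
by rewrite mul1r /toQq => /eqP; rewrite tofrac_eq => /eqP.
Qed.
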